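(* Let $C_1,C_2\in\mathbb{N}$ and $\beta_1,\beta_2,\ell\in\mathbb{N}$ with $\log_2 C_1\le\beta_1$ and $\log_2 C_2\le\beta_2$. Call a prime $p$ useful if $p\nmid C_1$ and $(p-1)\nmid C_2$. Let $\mu>0$ be a constant such that for all $n>\mu$ and for all integers $q\in\{n,\dots,2n\}$ with fewer than $\mu n/\log^2 n$ exceptions, $S(q)<q^{1.89}$. Define $\Upsilon(x)=\frac{3x}{5\log x}-\frac{\mu x}{\log^2 x}$. Let $n$ be the smallest integer such that $n>21$, $n>\mu$ and $\Upsilon(n)>\beta_1+\beta_2+\ell$. Define $$\mathcal{Q}=\{q \text{ prime}: n\le q<2n \text{ and } S(q)<q^{1.89}\},\qquad \mathcal{P}=\{S(q): q\in\mathcal{Q}\}.$$ Then the number of primes in $\mathcal{P}$ is at least $\beta_1+\beta_2+\ell$, the number of useful primes in $\mathcal{P}$ is at least $\ell$, and every $p\in\mathcal{P}$ satisfies $p\in O\big((\beta_1+\beta_2+\ell)^{1.89}\log^{1.89}(\beta_1+\beta_2+\ell)\big)$.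
   Context: For an integer $q$, $S(q)$ denotes the smallest prime $p$ such that $q\mid (p-1)$. Here $\log$ denotes the natural logarithm. *)

(* Defs.v *)
From mathcomp Require Import all_boot.
From Stdlib Require Import Reals ClassicalEpsilon.

Set Implicit Arguments.
Unset Strict Implicit.
Unset Printing Implicit Defensive.

(* S(q) = the smallest prime p with q | p - 1 (0 if no such prime exists;
   by Dirichlet this never happens for q >= 1). *)
Definition Spred (q : nat) : pred nat := fun p => prime p && (q %| p.-1).

Definition S (q : nat) : nat :=
  match excluded_middle_informative (exists p, Spred q p) with
  | left H => ex_minn H
  | right _ => 0
  end.

Definition e189 : R := (189 / 100)%R.

Definition Slt (q : nat) : bool :=
  if Rlt_dec (INR (S q)) (Rpower (INR q) e189) then true else false.

(* The hypothesis on mu: for all integers n > mu, the number of integers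
   q in {n, ..., 2n} with S(q) >= q^{1.89} is less than mu n / log^2 n.
   (Written multiplied out by log^2 n, so that n = 1, where log^2 n = 0,
   imposes no constraint, matching mu n / 0 = +infinity.) *)
Definition mu_hyp (mu : R) : Prop :=
  forall n : nat, (mu < INR n)%R ->
    (INR (count (fun q => ~~ Slt q) (iota n n.+1)) * (ln (INR n)) ^ 2
       < mu * INR n)%R.

Definition Upsilon (mu x : R) : R :=
  (3 * x / (5 * ln x) - mu * x / (ln x) ^ 2)%R.

Definition n_cond (mu : R) (beta : nat) (n : nat) : Prop :=
  21 < n /\ (mu < INR n)%R /\ (INR beta < Upsilon mu (INR n))%R.

Definition is_first_n (mu : R) (beta : nat) (n : nat) : Prop :=
  n_cond mu beta n /\ forall m : nat, m < n -> ~ n_cond mu beta m.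

Definition Qseq (n : nat) : seq nat :=
  [seq q <- iota n n | prime q && Slt q].

Definition Pseq (n : nat) : seq nat := undup (map S (Qseq n)).

Definition useful (C1 C2 p : nat) : bool := ~~ (p %| C1) && ~~ (p.-1 %| C2).

Definition log2 (x : R) : R := (ln x / ln 2)%R.

(* Main.v *)
From Coquelicot Require Import Coquelicot.
Require Import Defs.
From mathcomp Require Import all_boot cyclic.
From Stdlib Require Import Reals Lra ZArith.
From mathcomp Require Import zify.

(* There are at least 3 n / (5 log n) primes in [n, 2 n) as soon as n > 21: with
   psi x = log lcm (1, ..., x), the factorial ratio
   N! (N/30)! / ((N/2)! (N/3)! (N/5)!) gives Chebyshev's
   A x - O(log x) <= psi x <= (6/5) A x + O(log^2 x) with A = 0.921..., and
   psi (2 n) - psi n - psi (sqrt (2 n)) <= (number of primes) * log (2 n)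
   settles n >= 4096; smaller n are left to a computation.  Removing the
   exceptional q leaves more than b1 + b2 + l primes in Q.  On Q the map S is
   injective, and S q | C1, respectively S q - 1 | C2 (hence q | C2), can
   happen for at most b1, respectively b2, values of q. *)

Local Open Scope nat_scope.
(* Reals rebinds this notation to Nat.pow. *)
Local Notation "m ^ n" := (expn m n) : nat_scope.

(** * Logarithms and factorials *)

Lemma incr_from_derive (f f' : R -> R) (a b : R) : (a <= b)%R ->
  (forall x, a <= x <= b -> is_derive f x (f' x))%R ->
  (forall x, a <= x <= b -> 0 <= f' x)%R -> (f a <= f b)%R.
Proof.
move=> ab df f'_ge0.
have [c [Hc Ec]] : exists c, (a <= c <= b /\ f b - f a = f' c * (b - a))%R.
  have := MVT_gen f a b f'; rewrite Rmin_left // Rmax_right //; apply=> x Hx.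
    by apply: df; lra.
  apply/continuity_pt_filterlim; apply: (ex_derive_continuous f).
  by exists (f' x); apply: df.
have := f'_ge0 c Hc; nra.
Qed.

(** The difference of the two sides vanishes at 1 and has a nonnegative derivative. This bound and
    the next agree with [ln t] to second order at 1, the precision that Stirling-type estimates
    require. *)
Lemma ln_lower (t : R) : (1 <= t -> 2 * (t - 1) / (t + 1) <= ln t)%R.
Proof.
move=> Ht; suff : (0 <= ln t - 2 * (t - 1) / (t + 1))%R by lra.
apply: Rle_trans (incr_from_derive (fun x => ln x - 2 * (x - 1) / (x + 1))%R
  (fun c => (c - 1) ^ 2 / (c * (c + 1) ^ 2))%R _ _ Ht _ _).
- by rewrite ln_1; apply: Req_le; field.
- move=> x Hx; auto_derive; first by split; lra.
  by field; lra.
- move=> x Hx; apply: Rdiv_le_0_compat; [nra | apply: Rmult_lt_0_compat; nra].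
Qed.

Lemma ln_upper (t : R) : (1 <= t -> ln t <= (t - / t) / 2)%R.
Proof.
move=> Ht; suff : (0 <= (t - / t) / 2 - ln t)%R by lra.
apply: Rle_trans (incr_from_derive (fun x => (x - / x) / 2 - ln x)%R
  (fun c => (1 - / c) ^ 2 / 2)%R _ _ Ht _ _).
- by rewrite ln_1; apply: Req_le; field.
- move=> x Hx; auto_derive; first by repeat split; lra.
  by field; lra.
- by move=> x _; have := pow2_ge_0 (1 - / x); lra.
Qed.

Lemma ln_div_bounds (a b : R) : (0 < b <= a ->
  2 * (a - b) / (a + b) <= ln a - ln b <= (a ^ 2 - b ^ 2) / (2 * a * b))%R.
Proof.
move=> [b0 ba].
have t1 : (1 <= a / b)%R by apply/Rle_div_r; lra.
have <- : (ln (a / b) = ln a - ln b)%R by apply: ln_div; lra.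
split.
  have := ln_lower _ t1.
  have -> // : (2 * (a / b - 1) / (a / b + 1) = 2 * (a - b) / (a + b))%R.
  by field; lra.
have := ln_upper _ t1.
have -> // : ((a / b - / (a / b)) / 2 = (a ^ 2 - b ^ 2) / (2 * a * b))%R.
by field; lra.
Qed.

(* 16/15, 25/24 and 81/80 generate the multiplicative group spanned by 2, 3, 5. *)
Lemma ln_2_3_5_bounds :
  (0.6929 <= ln 2 <= 0.6936 /\ 1.0983 <= ln 3 <= 1.0993 /\
   1.6090 <= ln 5 <= 1.6104)%R.
Proof.
have lM (a b : R) : (0 < a -> 0 < b -> ln (a * b) = ln a + ln b)%R by exact: ln_mult.
have l4 : (ln 4 = ln 2 + ln 2)%R by rewrite -lM; [congr ln; lra | lra | lra].
have l16 : (ln 16 = ln 4 + ln 4)%R by rewrite -lM; [congr ln; lra | lra | lra].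
have l15 : (ln 15 = ln 3 + ln 5)%R by rewrite -lM; [congr ln; lra | lra | lra].
have l25 : (ln 25 = ln 5 + ln 5)%R by rewrite -lM; [congr ln; lra | lra | lra].
have l8 : (ln 8 = ln 4 + ln 2)%R by rewrite -lM; [congr ln; lra | lra | lra].
have l24 : (ln 24 = ln 8 + ln 3)%R by rewrite -lM; [congr ln; lra | lra | lra].
have l9 : (ln 9 = ln 3 + ln 3)%R by rewrite -lM; [congr ln; lra | lra | lra].
have l81 : (ln 81 = ln 9 + ln 9)%R by rewrite -lM; [congr ln; lra | lra | lra].
have l80 : (ln 80 = ln 16 + ln 5)%R by rewrite -lM; [congr ln; lra | lra | lra].
have H1 := ln_div_bounds 16 15 ltac:(lra).
have H2 := ln_div_bounds 25 24 ltac:(lra).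
have H3 := ln_div_bounds 81 80 ltac:(lra).
lra.
Qed.

Lemma INR_fact_gt0 (k : nat) : (0 < INR k`!)%R.
Proof. by apply: lt_0_INR; apply/ltP; exact: fact_gt0. Qed.

Lemma ln_fact_bounds (k : nat) : 0 < k ->
  ((INR k + / 2) * ln (INR k) - INR k + 3 / 4 <= ln (INR k`!)
    <= (INR k + / 2) * ln (INR k) - INR k + 1)%R.
Proof.
(* The term 1 / (4 k) makes the lower bound inductive: by ln_div_bounds,
   (k + 1/2) ln (1 + 1/k) <= 1 + 1/(4k) - 1/(4(k+1)). *)
suff H : 0 < k ->
  ((INR k + / 2) * ln (INR k) - INR k + 3 / 4 + / (4 * INR k) <= ln (INR k`!)
    <= (INR k + / 2) * ln (INR k) - INR k + 1)%R.
  move=> k0; have [h1 h2] := H k0; split=> //.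
  have : (0 < / (4 * INR k))%R.
    apply: Rinv_0_lt_compat; have : (0 < INR k)%R by apply: lt_0_INR; lia.
    lra.
  lra.
case: k => // k _; elim: k => [|k IH].
  rewrite (_ : 1`! = 1) //= ln_1; lra.
have k0 : (0 < INR k.+1)%R by apply: lt_0_INR; lia.
rewrite factS -multE mult_INR ln_mult //; last exact: INR_fact_gt0.
  have := ln_div_bounds (INR k.+2) (INR k.+1).
  rewrite [INR k.+2]S_INR; move: IH k0; move: (INR k.+1) => x IH x0.
  case; first lra.
  move=> h1 h2.
  (* The upper bound needs only this, since 2 (x + 1/2) / (2 x + 1) is exactly 1. *)
  have g1 : (1 <= (x + / 2) * (ln (x + 1) - ln x))%R.
    apply: Rle_trans (_ : (x + / 2) * (2 * (x + 1 - x) / (x + 1 + x)) <= _)%R.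
      by apply: Req_le; field; lra.
    by apply: Rmult_le_compat_l => //; lra.
  have g2 : ((x + / 2) * (ln (x + 1) - ln x) <= 1 + / (4 * x) - / (4 * (x + 1)))%R.
    apply: Rle_trans (_ : _ <= (x + / 2) * (((x + 1) ^ 2 - x ^ 2) / (2 * (x + 1) * x)))%R _.
      by apply: Rmult_le_compat_l => //; lra.
    by apply: Req_le; field; lra.
  split; nra.
by apply: lt_0_INR; lia.
Qed.

(** Follows from y ln (x / y) <= x - y and ln x >= 0. It moves factorial estimates from the integer
    part of N / d to N / d itself. *)
Lemma entropy_le (x y : R) : (1 <= x <= y -> x * ln x - x <= y * ln y - y)%R.
Proof.
move=> [x1 xy].
have lx : (0 <= ln x)%R by rewrite -ln_1; apply: ln_le; lra.
have : (y * (ln x - ln y) <= x - y)%R.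
  rewrite -ln_div; try lra.
  apply: Rle_trans (_ : y * (x / y - 1) <= _)%R.
    apply: Rmult_le_compat_l; first lra.
    rewrite -[X in (_ <= X)%R]ln_exp; apply: ln_le; first by apply: Rdiv_lt_0_compat; lra.
    have := exp_ineq1_le (x / y - 1); lra.
  by apply: Req_le; field; lra.
nra.
Qed.

(** * Chebyshev divisibilities *)

Lemma dvdn_logn m n : 0 < m -> 0 < n ->
  (forall p, prime p -> logn p m <= logn p n) -> m %| n.
Proof.
move=> m0 n0 H; apply/dvdn_partP => // p; rewrite mem_primes => /and3P[pp _ _].
by rewrite p_part pfactor_dvdn // H.
Qed.

(** This is lcm (1, ..., N), given by its factorisation so that valuations are immediate. *)
Definition lcm_upto (N : nat) : nat :=
  \prod_(0 <= p < N.+1 | prime p) p ^ trunc_log p N.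

Lemma lcm_upto_gt0 N : 0 < lcm_upto N.
Proof. by apply: prodn_cond_gt0 => p pp; rewrite expn_gt0 prime_gt0. Qed.

Lemma logn_prod_cond p (r : seq nat) (P : pred nat) (F : nat -> nat) :
  (forall i, P i -> 0 < F i) ->
  logn p (\prod_(i <- r | P i) F i) = \sum_(i <- r | P i) logn p (F i).
Proof.
move=> F0; elim: r => [|i r IH]; first by rewrite !big_nil logn1.
rewrite !big_cons; case: ifP => // Pi.
by rewrite lognM ?F0 // ?IH //; apply: prodn_cond_gt0.
Qed.

Lemma logn_lcm_upto p N : prime p -> logn p (lcm_upto N) = trunc_log p N.
Proof.
move=> pp; rewrite logn_prod_cond; last by move=> i ip; rewrite expn_gt0 prime_gt0.
have E i : prime i -> logn p (i ^ trunc_log i N) = if i == p then trunc_log p N else 0.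
  move=> ip; rewrite lognX logn_prime //; rewrite eq_sym; case: eqP => [->|_]; by rewrite ?muln1 ?muln0.
rewrite (eq_bigr _ E) big_mkcond /=.
case: (ltnP p N.+1) => Np.
  have U : uniq (index_iota 0 N.+1) := iota_uniq _ _.
  rewrite (bigD1_seq p) ?mem_index_iota // eqxx pp.
  by rewrite big1 => [|i /negPf->]; rewrite ?if_same //= addn0.
rewrite big_nat_cond big1 => [|i /andP[iN _]]; last first.
  by case: ifP => // _; case: eqP => // ip; lia.
by apply/esym/eqP; rewrite trunc_log_eq0; apply/orP; right; lia.
Qed.

(** The sum counts the k >= 1 with p ^ k <= M. It has the shape of Legendre's formula, and the free
    upper end [N] lets several values of [M] share one range, so that valuations compare term by
    term. *)
Lemma trunc_log_sum p N M : 1 < p -> M <= N ->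
  trunc_log p M = \sum_(1 <= k < N.+1) (1 <= M %/ p ^ k).
Proof.
move=> p1 MN.
case: M MN => [|M] MN; first by rewrite trunc_log0 big1 // => k _; rewrite div0n.
have E k : (1 <= M.+1 %/ p ^ k) = (k <= trunc_log p M.+1).
  rewrite divn_gt0 ?expn_gt0 ?(ltnW p1) //; apply/idP/idP => h; first exact: trunc_log_max.
  by apply: leq_trans (trunc_logP p1 _); rewrite // leq_pexp2l // ltnW.
rewrite (eq_bigr (fun k => (k <= trunc_log p M.+1) : nat)) => [|k _]; last by rewrite E.
have tN : trunc_log p M.+1 <= N.
  apply: leq_trans MN; apply: leq_trans (trunc_logP p1 (ltn0Sn M)).
  exact/ltnW/ltn_expl.
rewrite (big_cat_nat (n := (trunc_log p M.+1).+1)) //=.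
rewrite big_nat_cond (eq_bigr (fun=> 1)); last by move=> i /andP[/andP[_ h] _]; lia.
rewrite -big_nat_cond sum_nat_const_nat big_nat_cond big1 ?addn0; first by lia.
by move=> i /andP[/andP[h _] _]; lia.
Qed.

Lemma logn_fact_wide p N M : prime p -> M <= N ->
  logn p M`! = \sum_(1 <= k < N.+1) M %/ p ^ k.
Proof.
move=> pp MN; rewrite logn_fact // [RHS](big_cat_nat (n := M.+1)) //=.
rewrite [X in _ = _ + X]big_nat_cond [X in _ = _ + X]big1 ?addn0 // => i /andP[/andP[h _] _].
apply: divn_small; apply: leq_trans h _; apply: ltnW; apply: ltn_expl; exact: prime_gt1.
Qed.

(** Legendre's formula with the two divisions exchanged: each term depends only on t = N %/ p ^ k
    and d. *)
Lemma logn_fact_div p N d : prime p -> 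
  logn p (N %/ d)`! = \sum_(1 <= k < N.+1) (N %/ p ^ k) %/ d.
Proof.
move=> pp; rewrite (@logn_fact_wide p N) ?leq_div //.
by apply: eq_bigr => k _; rewrite -!divnMA mulnC.
Qed.

Lemma divnAC m d e : m %/ d %/ e = m %/ e %/ d.
Proof. by rewrite -!divnMA mulnC. Qed.

(* Both divisibilities are read off p-adic valuations, from 0 <= f <= 1 and
   f = 1 on [1, 6) for f(t) = [t] - [t/2] - [t/3] - [t/5] + [t/30]. *)
Lemma chebyshev_dvd_lcm N :
  N`! * (N %/ 30)`! %| (N %/ 2)`! * (N %/ 3)`! * (N %/ 5)`! * lcm_upto N.
Proof.
apply: dvdn_logn => [||p pp]; rewrite ?muln_gt0 ?fact_gt0 ?lcm_upto_gt0 //.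
rewrite !lognM ?muln_gt0 ?fact_gt0 ?lcm_upto_gt0 // logn_lcm_upto //.
rewrite (@trunc_log_sum p N) ?prime_gt1 // !(@logn_fact_div p N) // (@logn_fact_wide p N) //.
rewrite -!big_split /=; apply: leq_sum => k _; move: (N %/ _) => t. lia.
Qed.

Lemma lcm_dvd_chebyshev N :
  lcm_upto N * ((N %/ 2)`! * (N %/ 3)`! * (N %/ 5)`!) %|
  N`! * (N %/ 30)`! * lcm_upto (N %/ 6).
Proof.
apply: dvdn_logn => [||p pp]; rewrite ?muln_gt0 ?fact_gt0 ?lcm_upto_gt0 //.
rewrite !lognM ?muln_gt0 ?fact_gt0 ?lcm_upto_gt0 // !logn_lcm_upto //.
rewrite !(@trunc_log_sum p N) ?prime_gt1 ?leq_div // !(@logn_fact_div p N) // (@logn_fact_wide p N) //.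
rewrite -!big_split /=; apply: leq_sum => k _.
by rewrite (divnAC N 6); move: (N %/ _) => t; lia.
Qed.

(** Compare exponents prime by prime. For p <= s, doubling n raises the exponent by at most 1, which
    [lcm_upto s] pays for. For p > s the exponent in [lcm_upto (2 * n)] is at most 1, as p ^ 2 > 2
    n; it is supplied by [lcm_upto n] if p <= n and by the product if n < p < 2 n, while 2 n is not
    prime. *)
Lemma lcm_upto_double n s : 1 < n -> 2 * n < s.+1 ^ 2 ->
  lcm_upto (2 * n) %|
  lcm_upto n * (\prod_(p <- iota n n | prime p) p) * lcm_upto s.
Proof.
move=> n1 ns; have Q0 : 0 < \prod_(p <- iota n n | prime p) p.
  by apply: prodn_cond_gt0 => p; apply: prime_gt0.
apply: dvdn_logn => [||p pp]; rewrite ?muln_gt0 ?lcm_upto_gt0 ?Q0 //.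
rewrite !lognM ?muln_gt0 ?lcm_upto_gt0 ?Q0 // !logn_lcm_upto //.
have p1 := prime_gt1 pp.
have bnd N k : N < p ^ k.+1 -> trunc_log p N <= k.
  case: (posnP N) => [->|N0 h]; first by rewrite trunc_log0.
  rewrite -ltnS -(ltn_exp2l _ _ p1); apply: leq_ltn_trans h; exact: trunc_logP.
case: (leqP p s) => ps.
  have t1 : 1 <= trunc_log p s by apply: trunc_log_max; rewrite ?expn1.
  suff : trunc_log p (2 * n) <= (trunc_log p n).+1 by lia.
  apply: bnd; rewrite expnS; apply: leq_ltn_trans (_ : p * n < _).
    by rewrite leq_mul2r p1 orbT.
  by rewrite ltn_mul2l (ltnW p1) trunc_log_ltn.
have t1 : trunc_log p (2 * n) <= 1.
  by apply: bnd; apply: leq_trans ns _; rewrite leq_exp2r.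
case: (leqP p n) => pn.
  have : 1 <= trunc_log p n by apply: trunc_log_max; rewrite ?expn1.
  lia.
case: (leqP p (2 * n)) => p2n; last first.
  have : trunc_log p (2 * n) <= 0 by apply: bnd; rewrite expn1.
  lia.
suff : 1 <= logn p (\prod_(p <- iota n n | prime p) p) by lia.
have p_ne : p != 2 * n.
  by apply/eqP => E; move: pp; rewrite E; apply/negP/primePn; right; exists 2; rewrite ?dvdn_mulr //; lia.
have p_in : p \in iota n n by rewrite mem_iota; lia.
rewrite -(pfactor_dvdn 1) // expn1 big_mkcond (bigD1_seq p) ?iota_uniq //=.
by rewrite pp dvdn_mulr.
Qed.

(** * Bounds on the Chebyshev function *)

Lemma ln_INR_dvd (m n : nat) : 0 < m -> 0 < n -> m %| n -> (ln (INR m) <= ln (INR n))%R.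
Proof.
move=> m0 n0 mn; apply: ln_le; first by apply: lt_0_INR; lia.
by apply: le_INR; apply/leP; apply: dvdn_leq.
Qed.

Lemma ln_INR_mul (m n : nat) : 0 < m -> 0 < n -> ln (INR (m * n)) = (ln (INR m) + ln (INR n))%R.
Proof. by move=> m0 n0; rewrite -multE mult_INR ln_mult //; apply: lt_0_INR; lia. Qed.

Lemma INR_expn (m k : nat) : INR (m ^ k) = (INR m ^ k)%R.
Proof. by elim: k => [|k IH] //; rewrite expnS -multE mult_INR IH. Qed.

Lemma INR_divn_bounds (N d : nat) : 0 < d ->
  (INR (N %/ d) <= INR N / INR d < INR (N %/ d) + 1)%R.
Proof.
move=> d0; have dR : (0 < INR d)%R by apply: lt_0_INR; lia.
split.
  apply/Rle_div_r => //; rewrite -mult_INR; apply: le_INR; apply/leP.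
  exact: leq_divM.
apply/Rlt_div_l => //; rewrite -S_INR -mult_INR; apply: lt_INR; apply/ltP.
exact: ltn_ceil.
Qed.

(** With k the integer part of x, the upper bound comes from k! and k <= x, the lower one from k! =
    (k + 1)! / (k + 1) and x < k + 1 <= 2 x. *)
Lemma ln_fact_divn_bounds (N d : nat) (x := (INR N / INR d)%R) : 0 < d <= N ->
  (x * ln x - x - / 2 * (ln 2 + ln x) + 3 / 4 <= ln (INR (N %/ d)`!)
    <= x * ln x - x + / 2 * ln x + 1)%R.
Proof.
move=> /andP[d0 dN]; have [kx xk] := INR_divn_bounds N d d0; rewrite -/x in kx xk.
set k := N %/ d in kx xk *.
have k0 : 0 < k by rewrite divn_gt0.
have kR : (1 <= INR k)%R by apply: (le_INR 1); lia.
have [_ up] := ln_fact_bounds k k0.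
have [lo _] := ln_fact_bounds k.+1 isT.
split.
  have E := entropy_le x (INR k.+1).
  move: lo E; rewrite S_INR factS ln_INR_mul // ?fact_gt0 // S_INR => lo E.
  have : (ln (INR k + 1) <= ln 2 + ln x)%R.
    by rewrite -ln_mult; try lra; apply: ln_le; lra.
  have : (x * ln x - x <= (INR k + 1) * ln (INR k + 1) - (INR k + 1))%R by apply: E; lra.
  lra.
have : (ln (INR k) <= ln x)%R by apply: ln_le; lra.
have : (INR k * ln (INR k) - INR k <= x * ln x - x)%R by apply: entropy_le; lra.
lra.
Qed.

Definition psi (N : nat) : R := ln (INR (lcm_upto N)).

(** Chebyshev's constant ln (2^(1/2) 3^(1/3) 5^(1/5) / 30^(1/30)), expanded in ln 2, ln 3, ln 5. *)
Definition chebyshev_A : R := (14 / 30 * ln 2 + 9 / 30 * ln 3 + 5 / 30 * ln 5)%R.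

(** Since 1 + 1/30 = 1/2 + 1/3 + 1/5, the terms N ln N and N cancel; the logarithms of 2, 3, 5, 30
    leave the linear term. *)
Lemma ln_fact_chebyshev (N : nat) : 30 <= N ->
  (chebyshev_A * INR N - 3 / 2 * ln (INR N) <=
     ln (INR N`!) + ln (INR (N %/ 30)`!)
       - (ln (INR (N %/ 2)`!) + ln (INR (N %/ 3)`!) + ln (INR (N %/ 5)`!)) <=
   chebyshev_A * INR N + 5 / 2 * ln (INR N) - 2)%R.
Proof.
move=> N30.
have [[a1 a2] [[b1 b2] [c1 c2]]] := ln_2_3_5_bounds.
have NR : (30 <= INR N)%R by rewrite (_ : 30%R = INR 30); [apply: le_INR; lia | rewrite /=; lra].
have H1 := ln_fact_divn_bounds N 1 ltac:(lia).
have H2 := ln_fact_divn_bounds N 2 ltac:(lia).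
have H3 := ln_fact_divn_bounds N 3 ltac:(lia).
have H5 := ln_fact_divn_bounds N 5 ltac:(lia).
have H30 := ln_fact_divn_bounds N 30 ltac:(lia).
have H0 := ln_fact_bounds N ltac:(lia).
have e2 : INR 2 = 2%R by rewrite /=; lra.
have e3 : INR 3 = 3%R by rewrite /=; lra.
have e5 : INR 5 = 5%R by rewrite /=; lra.
have e30 : INR 30 = 30%R by rewrite /=; lra.
rewrite e2 in H2; rewrite e3 in H3; rewrite e5 in H5; rewrite e30 in H30.
have l30 : (ln 30 = ln 2 + (ln 3 + ln 5))%R by rewrite -!ln_mult; try lra; congr ln; lra.
rewrite ln_div in H2; try lra. rewrite ln_div in H3; try lra.
rewrite ln_div in H5; try lra. rewrite ln_div in H30; try lra.
rewrite l30 in H30; rewrite /chebyshev_A.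
split; lra.
Qed.

Lemma psi_lower (N : nat) : 30 <= N ->
  (chebyshev_A * INR N - 3 / 2 * ln (INR N) <= psi N)%R.
Proof.
move=> N30; have [lo _] := ln_fact_chebyshev N N30.
have := ln_INR_dvd _ _ _ _ (chebyshev_dvd_lcm N).
rewrite !ln_INR_mul ?muln_gt0 ?fact_gt0 ?lcm_upto_gt0 //= => /(_ isT isT).
rewrite /psi; lra.
Qed.

Lemma psi_step (N : nat) : 30 <= N ->
  (psi N <= psi (N %/ 6) + chebyshev_A * INR N + 5 / 2 * ln (INR N) - 2)%R.
Proof.
move=> N30; have [_ up] := ln_fact_chebyshev N N30.
have := ln_INR_dvd _ _ _ _ (lcm_dvd_chebyshev N).
rewrite !ln_INR_mul ?muln_gt0 ?fact_gt0 ?lcm_upto_gt0 //= => /(_ isT isT).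
rewrite /psi; lra.
Qed.

Lemma ln_INR_ge0 (N : nat) : (0 <= ln (INR N))%R.
Proof.
case: N => [|N]; last by rewrite -ln_1; apply: ln_le; [lra | apply: (le_INR 1); lia].
(* At [N = 0], [ln] takes its default value 0. *)
rewrite /ln; case: Rlt_dec => [h|_]; [by case: (Rlt_irrefl _ h) | exact: Rle_refl].
Qed.

Lemma lcm_upto_leq (m n : nat) : m <= n -> lcm_upto m %| lcm_upto n.
Proof.
move=> mn; apply: dvdn_logn => [||p pp]; rewrite ?lcm_upto_gt0 // !logn_lcm_upto //.
exact: leq_trunc_log.
Qed.

Lemma prod_nat_const_seq (I : Type) (r : seq I) (P : pred I) (m : nat) :
  \prod_(i <- r | P i) m = m ^ count P r.
Proof. by rewrite big_const_seq; elim: (count P r) => [|k IH] /=; rewrite ?expn0 ?expnS ?IH. Qed.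

Lemma psi_le_count (N : nat) : 0 < N ->
  (psi N <= INR (count prime (iota 0 N.+1)) * ln (INR N))%R.
Proof.
move=> N0.
have H : lcm_upto N <= N ^ count prime (iota 0 N.+1).
  rewrite -prod_nat_const_seq; apply: leq_prod => p pp.
  by apply: trunc_logP; rewrite ?prime_gt1.
rewrite -ln_pow; last by apply: lt_0_INR; lia.
apply: ln_le; first by apply: lt_0_INR; have := lcm_upto_gt0 N; lia.
by rewrite -INR_expn; apply: le_INR; apply/leP.
Qed.

Lemma psi_small (N : nat) : N < 30 -> (psi N <= 35)%R.
Proof.
move=> N30; apply: Rle_trans (_ : psi 29 <= _)%R.
  by apply: ln_INR_dvd; [exact: lcm_upto_gt0 | exact: lcm_upto_gt0 | apply: lcm_upto_leq].
have := psi_le_count 29 isT; rewrite (_ : count _ _ = 10); last by vm_compute.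
(* 29 < 2 ^ 5, and 10 * 5 * 0.6936 < 35. *)
have : (ln (INR 29) <= 5 * ln 2)%R.
  rewrite (_ : 5%R = INR 5); last by rewrite /=; lra.
  rewrite -ln_pow; last lra.
  by apply: ln_le; rewrite /=; lra.
have [[_ h] _] := ln_2_3_5_bounds; rewrite (_ : INR 10 = 10)%R; [lra | rewrite /=; lra].
Qed.

(** Iterating [psi_step] along N, N / 6, N / 36, ... sums a geometric series of ratio 1/6, whence
    6/5. Passing from N / 6 to N raises the squared logarithm by at least 2 ln 6 ln N - (ln 6) ^ 2,
    which absorbs 5/2 ln N - 2; 35 is the base case. *)
Lemma psi_upper (N : nat) :
  (psi N <= 6 / 5 * chebyshev_A * INR N + ln (INR N) ^ 2 + 35)%R.
Proof.
have [[a1 a2] [[b1 b2] [c1 c2]]] := ln_2_3_5_bounds.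
have A0 : (0 < chebyshev_A)%R by rewrite /chebyshev_A; lra.
elim/ltn_ind: N => N IH.
case: (ltnP N 30) => N30.
  have := psi_small N N30; have := pos_INR N; have := pow2_ge_0 (ln (INR N)).
  nra.
have H := IH (N %/ 6) ltac:(lia).
have S1 := psi_step N N30.
have [k1 _] := INR_divn_bounds N 6 isT.
have NR : (30 <= INR N)%R by rewrite (_ : 30%R = INR 30); [apply: le_INR; lia | rewrite /=; lra].
have kR : (1 <= INR (N %/ 6))%R by apply: (le_INR 1); lia.
have e6 : INR 6 = 6%R by rewrite /=; lra.
rewrite e6 in k1.
have L : (ln (INR (N %/ 6)) <= ln (INR N) - (ln 2 + ln 3))%R.
  rewrite -ln_mult; try lra.
  rewrite -ln_div; try lra; apply: ln_le; lra.
have l0 := ln_INR_ge0 (N %/ 6).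
have y3 : (3.39 <= ln (INR N))%R.
  apply: Rle_trans (_ : ln 2 + (ln 3 + ln 5) <= _)%R; first lra.
  by rewrite -!ln_mult; try lra; apply: ln_le; lra.
move: L l0 y3 S1 H; set y := ln (INR N); set z := ln (INR (N %/ 6)) => L l0 y3 S1 H.
have : (z ^ 2 <= (y - (ln 2 + ln 3)) ^ 2)%R by apply: pow_incr; lra.
have w1 : (1.791 <= ln 2 + ln 3 <= 1.793)%R by lra.
have w2 : ((ln 2 + ln 3) ^ 2 <= 3.22)%R.
  by apply: Rle_trans (_ : 1.793 ^ 2 <= _)%R; [apply: pow_incr; lra | lra].
have w3 : (1.791 * y <= (ln 2 + ln 3) * y)%R by apply: Rmult_le_compat_r; lra.
have : (chebyshev_A * INR (N %/ 6) <= chebyshev_A * (INR N / 6))%R.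
  by apply: Rmult_le_compat_l; lra.
lra.
Qed.

Lemma ln_prod_primes (n : nat) : 1 < n ->
  (ln (INR (\prod_(p <- iota n n | prime p) p)) <=
   INR (count prime (iota n n)) * ln (INR (2 * n)))%R.
Proof.
move=> n1.
have H : \prod_(p <- iota n n | prime p) p <= (2 * n) ^ count prime (iota n n).
  rewrite -prod_nat_const_seq big_seq_cond [leqRHS]big_seq_cond.
  by apply: leq_prod => p /andP[]; rewrite mem_iota; lia.
have Q0 : 0 < \prod_(p <- iota n n | prime p) p.
  by apply: prodn_cond_gt0 => p; apply: prime_gt0.
rewrite -ln_pow; last by apply: lt_0_INR; lia.
apply: ln_le; first by apply: lt_0_INR; lia.
by rewrite -INR_expn; apply: le_INR; apply/leP.
Qed.

Lemma psi_double (n s : nat) : 1 < n -> 2 * n < s.+1 ^ 2 ->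
  (psi (2 * n) <= psi n + INR (count prime (iota n n)) * ln (INR (2 * n)) + psi s)%R.
Proof.
move=> n1 ns; have Q0 : 0 < \prod_(p <- iota n n | prime p) p.
  by apply: prodn_cond_gt0 => p; apply: prime_gt0.
have H := ln_INR_dvd _ _ _ _ (lcm_upto_double n s n1 ns).
rewrite !ln_INR_mul ?muln_gt0 ?lcm_upto_gt0 ?Q0 //= in H.
have := H isT isT; have := ln_prod_primes n n1.
rewrite /psi; lra.
Qed.

Lemma ex_isqrt (m : nat) : exists s, s ^ 2 <= m < s.+1 ^ 2.
Proof.
elim: m => [|m [s /andP[h1 h2]]]; first by exists 0.
case: (ltnP m.+1 (s.+1 ^ 2)) => h; first by exists s; lia.
exists s.+1; rewrite h /=; lia.
Qed.

(** * Primes in [n, 2 n) for n >= 4096 *)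

Lemma count_primes_large (n : nat) : 4096 <= n ->
  (3 * INR n <= 5 * ln (INR n) * INR (count prime (iota n n)))%R.
Proof.
move=> n4096.
have [[a1 a2] [[b1 b2] [c1 c2]]] := ln_2_3_5_bounds.
have A0 : (0.921 <= chebyshev_A <= 0.923)%R by rewrite /chebyshev_A; lra.
have [s /andP[s1 s2]] := ex_isqrt (2 * n).
have D := psi_double n s ltac:(lia) s2.
have P2 := psi_lower (2 * n) ltac:(lia).
have P1 := psi_upper n.
have Ps := psi_upper s.
have nR : (4096 <= INR n)%R.
  by rewrite (_ : 4096%R = INR 4096); [apply: le_INR; lia | rewrite INR_IZR_INZ; congr IZR].
have e2 : INR (2 * n) = (2 * INR n)%R by rewrite -multE mult_INR.
have l2n : ln (INR (2 * n)) = (ln 2 + ln (INR n))%R by rewrite e2 ln_mult; lra.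
have sR : (INR s ^ 2 <= 2 * INR n)%R by rewrite -e2 -INR_expn; apply: le_INR; lia.
rewrite l2n e2 in D P2.
set c := INR (count prime (iota n n)) in D *.
have c0 : (0 <= c)%R by apply: pos_INR.
set X := INR n in nR sR D P2 P1 *.
set y := ln X in D P2 P1 *.
pose r := sqrt X.
have rr : (r * r = X)%R by apply: sqrt_sqrt; lra.
have r64 : (64 <= r)%R.
  by rewrite /r (_ : 64 = sqrt (64 * 64))%R; [apply: sqrt_le_1; lra | rewrite sqrt_square; lra].
have l64 : ln 64 = (6 * ln 2)%R.
  rewrite (_ : 64 = 2 ^ 6)%R; last lra.
  rewrite ln_pow; last lra.
  by rewrite (_ : INR 6 = 6)%R //=; lra.
have yr : (y = 2 * ln r)%R by rewrite /y -rr ln_mult; lra.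
(* The tangent to ln at 64 = sqrt 4096; since r >= 64, it yields a bound on y proportional to r. *)
have yup : (ln r <= 6 * ln 2 + (r / 64 - 1))%R.
  have -> : ln r = (ln 64 + ln (r / 64))%R by rewrite ln_div; lra.
  rewrite l64; apply: Rplus_le_compat_l.
  rewrite -[X in (_ <= X)%R]ln_exp; apply: ln_le; first by lra.
  have := exp_ineq1_le (r / 64 - 1); lra.
have y_lo : (8.314 <= y)%R.
  rewrite yr; apply: Rle_trans (_ : 2 * ln 64 <= _)%R; first lra.
  have := ln_le 64 r; lra.
have y_up : (y <= 0.131 * r)%R by lra.
have s_up : (INR s <= 1.415 * r)%R.
  have s0 := pos_INR s.
  apply: Rnot_lt_le => h; have : (2 * X < INR s ^ 2)%R by nra.
  lra.
have ls : (ln (INR s) <= y)%R.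
  have s0 : 0 < s by case: (posnP s) s2 => // ->; lia.
  apply: ln_le; first by apply: lt_0_INR; lia.
  nra.
have ls0 := ln_INR_ge0 s.
have ls2 : (ln (INR s) ^ 2 <= y ^ 2)%R by apply: pow_incr; lra.
have y2 : (y ^ 2 <= 0.0172 * X)%R by nra.
have As : (chebyshev_A * INR s <= 0.923 * (1.415 * r))%R.
  by apply: Rmult_le_compat; try lra; exact: pos_INR.
have rX : (64 * r <= X)%R by nra.
(* 0.7368 = (2 - 6/5) * 0.921. The bracket collects the linear term of [psi s], two squared
   logarithms, the error of [psi_lower] and twice the constant 35. *)
have main : (0.7368 * X - (1.6 * r + 2 * y ^ 2 + 2 * y + 71) <= c * (y + 0.6936))%R.
  have : (0.921 * X <= chebyshev_A * X)%R by nra.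
  have : (c * (ln 2 + y) <= c * (y + 0.6936))%R by nra.
  lra.
have err : (1.6 * r + 2 * y ^ 2 + 2 * y + 71 <= 0.081 * X)%R by lra.
have m2 : (0.6558 * X <= c * (y + 0.6936))%R by lra.
(* Replaces ln (2 n) by ln n at the cost of a factor 1.0835, affordable because 0.6558 / 1.0835 >
   3/5. *)
have m3 : (c * (y + 0.6936) <= c * (y * 1.0835))%R by apply: Rmult_le_compat_l; lra.
lra.
Qed.

(** * Primes in [n, 2 n) for small n *)

(** Binary [N] keeps evaluation fast. Exhausted fuel answers [false], so only [true] carries
    information, and the counts below are lower bounds. *)
Fixpoint trial_division (fuel : nat) (p d : N) : bool :=
  if fuel is f.+1 then
    if (p <? d * d)%num then true
    else if (p mod d =? 0)%num then false else trial_division f p (d + 1)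
  else false.

Lemma trial_division_sound fuel (p d : N) : (1 < p)%num -> (1 < d)%num ->
  (forall e, 1 < e < N.to_nat d -> ~~ (e %| N.to_nat p)) ->
  trial_division fuel p d -> prime (N.to_nat p).
Proof.
elim: fuel d => [|f IH] d p1 d1 H //=.
case: N.ltb_spec0 => [pd _|_].
  apply: ltn_pdiv2_prime; first by lia.
  have n1 : 1 < N.to_nat p by lia.
  have dp : N.to_nat d <= pdiv (N.to_nat p).
    rewrite leqNgt; apply/negP => h; have := H (pdiv (N.to_nat p)).
    by rewrite h pdiv_dvd prime_gt1 ?pdiv_prime //= => /(_ isT).
  apply: leq_trans (_ : N.to_nat d ^ 2 <= _); last by rewrite leq_exp2r.
  lia.
case: N.eqb_spec => // nd; apply: IH => // [|e he]; first by lia.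
case: (ltnP e (N.to_nat d)) => ed; first by apply: H; lia.
have -> : e = N.to_nat d by lia.
apply/negP => /dvdnP[q Eq]; apply: nd.
have -> : p = (N.of_nat q * d)%num by lia.
by apply: N.Div0.mod_mul.
Qed.

Fixpoint count_trial (len : nat) (lo : N) : N :=
  if len is l.+1 then
    if trial_division 100 lo 2 then N.succ (count_trial l (N.succ lo))
    else count_trial l (N.succ lo)
  else 0%num.

Lemma count_trial_sound len lo : (1 < lo)%num ->
  N.to_nat (count_trial len lo) <= count prime (iota (N.to_nat lo) len).
Proof.
elim: len lo => // l IH lo lo1.
have := IH (N.succ lo) ltac:(lia).
rewrite [iota _ l.+1]/= [count _ (_ :: _)]/= (_ : N.to_nat (N.succ lo) = (N.to_nat lo).+1); last by lia.
rewrite (_ : count_trial l.+1 lo = if trial_division 100 lo 2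
  then N.succ (count_trial l (N.succ lo)) else count_trial l (N.succ lo)) //.
case E : (trial_division 100 lo 2); last by lia.
have -> : prime (N.to_nat lo) by apply: trial_division_sound E => // e; rewrite (_ : N.to_nat 2 = 2) //; lia.
lia.
Qed.

(* Uses ln n >= (N.log2 (a ^ 4) / 4) * 0.6929 for n >= a, where 0.6929 < ln 2. *)
Definition block_ok (a b : N) : bool :=
  [&& (1 <? a)%num, (b <=? 2 * a)%num &
   (30000 * 4 * b <=?
    5 * count_trial (N.to_nat (2 * a - b)) b * N.log2 (a ^ 4) * 6929)%num].

Fixpoint blocks_ok (a : N) (s : seq N) : bool :=
  if s is b :: s' then block_ok a b && blocks_ok b s' else true.

(** Consecutive entries bound blocks that together cover [22, 4640], past the start 4096 of the
    analytic estimate. *)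
Lemma blocks_ok_4096 : blocks_ok 22
  [:: 24; 29; 31; 37; 43; 48; 53; 61; 71; 83; 97; 112; 131; 153; 179; 209; 241;
      283; 332; 401; 471; 569; 683; 821; 998; 1193; 1447; 1741; 2110; 2578;
      3137; 3811; 4640]%num.
Proof. by vm_compute. Qed.

Lemma count_iota_sub (P : pred nat) (n b l m : nat) :
  n <= b -> b + l <= n + m -> count P (iota b l) <= count P (iota n m).
Proof.
move=> nb bl.
have -> : m = (b - n) + (l + (n + m - (b + l))) by lia.
rewrite iotaD count_cat iotaD count_cat (_ : n + (b - n) = b); lia.
Qed.

(** For every n in [a, b] the interval [b, 2 a) lies inside [n, 2 n), so one count serves the whole
    block. Taking the fourth power of a makes the integer logarithm accurate to within 1/4. *)
Lemma block_ok_sound (a b : N) (n : nat) : block_ok a b ->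
  N.to_nat a <= n <= N.to_nat b ->
  (3 * INR n <= 5 * ln (INR n) * INR (count prime (iota n n)))%R.
Proof.
move=> /and3P[/N.ltb_spec0 a1 /N.leb_spec0 ba /N.leb_spec0 H] /andP[an nb].
set c := count_trial _ _ in H.
have cn : N.to_nat c <= count prime (iota n n).
  apply: leq_trans (count_trial_sound _ _ _) _; first by lia.
  apply: count_iota_sub; lia.
have [h2 _] := N.log2_spec (a ^ 4) ltac:(lia).
set k := N.log2 (a ^ 4) in H h2.
have [[a2 _] _] := ln_2_3_5_bounds.
have k_n : 2 ^ N.to_nat k <= n ^ 4.
  apply: leq_trans (_ : N.to_nat a ^ 4 <= _); last by rewrite leq_exp2r.
  lia.
have nR : (1 <= INR n)%R by apply: (le_INR 1); lia.
have kR : (INR (N.to_nat k) * ln 2 <= 4 * ln (INR n))%R.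
  rewrite (_ : 4%R = INR 4); last by rewrite /=; lra.
  rewrite -!ln_pow; try lra.
  apply: ln_le; first by apply: pow_lt; lra.
  by rewrite -[2%R]/(INR 2) -!INR_expn; apply: le_INR; apply/leP.
have HR : (120000 * INR n <= 5 * INR (N.to_nat c) * INR (N.to_nat k) * 6929)%R.
  rewrite !INR_IZR_INZ -!mult_IZR; apply: IZR_le.
  move: H nb; move: c k {cn h2 k_n kR} => c k; lia.
have cR : (INR (N.to_nat c) <= INR (count prime (iota n n)))%R by apply: le_INR; apply/leP.
have c0 := pos_INR (N.to_nat c).
have k0 := pos_INR (N.to_nat k).
have l0 : (0 <= ln (INR n))%R by rewrite -ln_1; apply: ln_le; lra.
have k1 : (INR (N.to_nat k) * 0.6929 <= 4 * ln (INR n))%R by nra.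
apply: Rle_trans (_ : 5 * ln (INR n) * INR (N.to_nat c) <= _)%R; last by nra.
nra.
Qed.

Lemma blocks_ok_sound (s : seq N) (a : N) (n : nat) : blocks_ok a s ->
  N.to_nat a <= n -> n <= N.to_nat (last a s) -> s != [::] ->
  (3 * INR n <= 5 * ln (INR n) * INR (count prime (iota n n)))%R.
Proof.
elim: s a => //= b s IH a /andP[ab bs] an nl _.
case: (leqP n (N.to_nat b)) => nb; first by apply: (block_ok_sound a b); rewrite ?an.
apply: (IH b) => //; first exact: ltnW.
by case: s nl {IH bs} => //=; lia.
Qed.

Lemma count_primes_ge (n : nat) : 21 < n ->
  (3 * INR n <= 5 * ln (INR n) * INR (count prime (iota n n)))%R.
Proof.
move=> n21; case: (leqP 4096 n) => n4; first exact: count_primes_large.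
by apply: (blocks_ok_sound _ _ _ blocks_ok_4096) => //=; lia.
Qed.

(** * The map S on the primes of [n, 2 n) *)

(* Any prime divisor p of 2 ^ q - 1 works: the order of 2 modulo p divides the
   prime q and is not 1. *)
Lemma ex_prime_cong1 (q : nat) : prime q -> exists p, Spred q p.
Proof.
move=> pq; have q1 := prime_gt1 pq.
have x1 : 1 < 2 ^ q - 1.
  have : 2 ^ 2 <= 2 ^ q by rewrite leq_exp2l.
  rewrite (_ : 2 ^ 2 = 4) //; lia.
exists (pdiv (2 ^ q - 1)); set p := pdiv _.
have pp : prime p by apply: pdiv_prime.
rewrite /Spred pp /=; apply/negPn/negP => qn.
have p1 := prime_gt1 pp.
have cop : coprime q p.-1 by rewrite prime_coprime.
have E1 : 2 ^ q = 1 %[mod p].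
  apply/eqP; rewrite eqn_mod_dvd ?expn_gt0 //; exact: pdiv_dvd.
have p2 : ~~ (p %| 2).
  apply/negP => d; have := pdiv_dvd (2 ^ q - 1); rewrite -/p => d'.
  have : p %| 1; last by rewrite dvdn1; lia.
  have q0 : 0 < 2 ^ q by rewrite expn_gt0.
  have -> : 1 = 2 ^ q - (2 ^ q - 1) by lia.
  rewrite dvdn_sub //; apply: dvdn_trans d _.
  by rewrite -{1}(expn1 2) dvdn_exp2l // ltnW.
have E2 : 2 ^ p.-1 = 1 %[mod p].
  rewrite -(totient_prime pp); apply: Euler_exp_totient.
  by rewrite coprime_sym prime_coprime.
(* If q did not divide p - 1, Bezout's u q = v (p - 1) + 1 would give 1 = 2 modulo p. *)
have [[u v] /= Euv] := elimT (coprimeP p.-1 (prime_gt0 pq)) cop.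
have {}Euv : u * q = v * p.-1 + 1 by lia.
have F1 : 2 ^ (u * q) = 1 %[mod p].
  by rewrite mulnC expnM -modnXm E1 modnXm exp1n.
have F2 : 2 ^ (v * p.-1 + 1) = 2 %[mod p].
  by rewrite expnD mulnC expn1 mulnC (mulnC v) expnM -modnMml -modnXm E2 modnXm exp1n modnMml mul1n.
have : 2 = 1 %[mod p] by rewrite -F2 -Euv.
move/eqP; rewrite eqn_mod_dvd // dvdn1; lia.
Qed.

Lemma S_prime_spec (q : nat) : prime q -> prime (S q) && (q %| (S q).-1).
Proof.
move=> pq; rewrite /S; case: ClassicalEpsilon.excluded_middle_informative => [H|[]].
  by case: ex_minnP => p.
exact: ex_prime_cong1.
Qed.

Lemma Slt_ltR (q : nat) : Slt q -> (INR (S q) < Rpower (INR q) e189)%R.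
Proof. by rewrite /Slt; case: Rlt_dec. Qed.

Lemma Slt_lt_sqr (q : nat) : 0 < q -> Slt q -> S q < q ^ 2.
Proof.
move=> q0 /Slt_ltR h; apply/ltP/INR_lt; apply: Rlt_le_trans h _.
have qR : (1 <= INR q)%R by apply: (le_INR 1); lia.
rewrite INR_expn -Rpower_pow; last lra.
by apply: Rle_Rpower => //; rewrite /e189 /=; lra.
Qed.

Lemma mem_Qseq (n q : nat) :
  (q \in Qseq n) = [&& prime q, Slt q & n <= q < 2 * n].
Proof. by rewrite mem_filter mem_iota -andbA mul2n addnn. Qed.

(* A common value p = S q1 = S q2 with q1 < q2 would satisfy q1 * q2 <= p - 1,
   although p < q1 ^ 1.89. *)
Lemma S_inj_Qseq (n : nat) : {in Qseq n &, injective S}.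
Proof.
have W q1 q2 : q1 \in Qseq n -> q2 \in Qseq n -> S q1 = S q2 -> q1 < q2 -> False.
  rewrite !mem_Qseq => /and3P[p1 l1 _] /and3P[p2 _ _] E q12.
  have /andP[pS d1] := S_prime_spec _ p1; have /andP[_ d2] := S_prime_spec _ p2.
  rewrite -E in d2.
  have cop : coprime q1 q2.
    rewrite prime_coprime //; apply/negP; rewrite dvdn_prime2 // => /eqP; lia.
  have : q1 * q2 %| (S q1).-1 by rewrite Gauss_dvd // d1.
  have S1 := prime_gt1 pS.
  move/dvdn_leq => /(_ ltac:(lia)); have := Slt_lt_sqr _ (prime_gt0 p1) l1.
  have : q1 * q1 <= q1 * q2 by rewrite leq_mul2l (ltnW q12) orbT.
  rewrite -mulnn; lia.
move=> q1 q2 i1 i2 E; case: (ltngtP q1 q2) => // h; exfalso.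
  exact: (W q1 q2).
exact: (W q2 q1).
Qed.

(** By injectivity [undup] removes nothing, so P is as large as Q. *)
Lemma Pseq_map (n : nat) : Pseq n = [seq S q | q <- Qseq n].
Proof.
apply: undup_id; rewrite map_inj_in_uniq; last exact: S_inj_Qseq.
exact/filter_uniq/iota_uniq.
Qed.

(** * Size of Q, useful primes, and growth of n *)

(** Distinct primes dividing C have a product dividing C, and each is at least 2. The induction
    divides C by one prime at a time. *)
Lemma prod_primes_leq (s : seq nat) (C : nat) : 0 < C -> uniq s ->
  {in s, forall p, prime p && (p %| C)} -> 2 ^ size s <= C.
Proof.
elim: s C => [|p s IH] C C0 //= /andP[ps us] H.
have /andP[pp /dvdnP[C' E]] := H p (mem_head _ _).
have C'0 : 0 < C' by move: C0; rewrite E muln_gt0 => /andP[].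
have : 2 ^ size s <= C'.
  apply: IH => // q qs; have /andP[pq] := H q (mem_behead (s := p :: s) qs).
  rewrite pq /= E mulnC Gauss_dvdr // prime_coprime // dvdn_prime2 //.
  by apply: contraNneq ps => <-.
rewrite expnS E => h; apply: leq_trans (_ : p * C' <= _); last by rewrite mulnC.
by apply: leq_mul; rewrite ?prime_gt1.
Qed.

Lemma size_primes_leq (s : seq nat) (C b : nat) : 0 < C ->
  (log2 (INR C) <= INR b)%R -> uniq s ->
  {in s, forall p, prime p && (p %| C)} -> size s <= b.
Proof.
move=> C0 Cb us H; have hC := prod_primes_leq s C C0 us H.
apply/leP/INR_le; apply: Rle_trans Cb; rewrite /log2.
have [[l2 _] _] := ln_2_3_5_bounds.
apply/Rle_div_r; first lra.
rewrite -ln_pow; last lra.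
apply: ln_le; first by apply: pow_lt; lra.
by rewrite -[2%R]/(INR 2) -INR_expn; apply: le_INR; apply/leP.
Qed.

Lemma size_Qseq_gt (mu : R) (beta n : nat) : mu_hyp mu -> n_cond mu beta n ->
  beta < size (Qseq n).
Proof.
move=> Hmu [n21 [mun ups]]; apply/ltP/INR_lt; apply: Rlt_le_trans ups _.
have := Hmu n mun; set ex := count _ (iota n n.+1) => hex.
have pr := count_primes_ge n n21.
(* A prime of [n, 2 n) outside Q is exceptional; [ex] also ranges over 2 n, which can only enlarge
   it. *)
have sz : count prime (iota n n) <= size (Qseq n) + ex.
  rewrite /Qseq size_filter /ex -addn1 iotaD count_cat.
  rewrite addnA; apply: leq_trans (leq_addr _ _).
  elim: (iota n n) => //= q s; case: (prime q); case: (Slt q) => /=; lia.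
have szR : (INR (count prime (iota n n)) <= INR (size (Qseq n)) + INR ex)%R.
  by rewrite -plus_INR; apply: le_INR; apply/leP.
have nR : (21 < INR n)%R by rewrite (_ : 21%R = INR 21); [apply: lt_INR; lia | rewrite /=; lra].
have l0 : (0 < ln (INR n))%R by rewrite -ln_1; apply: ln_increasing; lra.
rewrite /Upsilon; move: l0 hex pr; set L := ln (INR n) => l0 hex pr.
have h1 : (INR ex <= mu * INR n / L ^ 2)%R.
  apply/Rle_div_r; [exact: pow_lt | lra].
have h2 : (3 * INR n / (5 * L) <= INR (count prime (iota n n)))%R.
  apply/Rle_div_l; lra.
lra.
Qed.

Lemma Qseq_prime (n q : nat) : q \in Qseq n -> prime q.
Proof. by rewrite mem_Qseq => /and3P[]. Qed.

Lemma Pseq_prime (n : nat) : all prime (Pseq n).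
Proof.
rewrite Pseq_map all_map; apply/allP => q /Qseq_prime pq /=.
by have /andP[] := S_prime_spec q pq.
Qed.

Lemma count_useful_Pseq (C1 C2 b1 b2 n : nat) : 0 < C1 -> 0 < C2 ->
  (log2 (INR C1) <= INR b1)%R -> (log2 (INR C2) <= INR b2)%R ->
  size (Qseq n) <= b1 + b2 + count (fun p => prime p && useful C1 C2 p) (Pseq n).
Proof.
move=> C10 C20 h1 h2.
have c1 : count (fun p => p %| C1) (Pseq n) <= b1.
  rewrite -size_filter; apply: (size_primes_leq _ C1) => //.
    exact/filter_uniq/undup_uniq.
  by move=> p; rewrite mem_filter => /andP[-> /(allP (Pseq_prime n)) ->].
(* Counted through q instead of S q - 1, which need not be prime: the q concerned are distinct
   primes dividing C2. *)
have c2 : count (fun p => p.-1 %| C2) (Pseq n) <= b2.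
  rewrite Pseq_map count_map -size_filter; apply: (size_primes_leq _ C2) => //.
    exact/filter_uniq/filter_uniq/iota_uniq.
  move=> q; rewrite mem_filter => /andP[/= d /Qseq_prime pq]; rewrite pq /=.
  by apply: dvdn_trans d; have /andP[] := S_prime_spec q pq.
have -> : size (Qseq n) = size (Pseq n) by rewrite Pseq_map size_map.
suff : size (Pseq n) <= count (fun p => p %| C1) (Pseq n) +
   count (fun p => p.-1 %| C2) (Pseq n) +
   count (fun p => prime p && useful C1 C2 p) (Pseq n) by lia.
elim: (Pseq n) (Pseq_prime n) => //= p s IH /andP[-> /IH].
by rewrite /useful; case: (p %| C1); case: (p.-1 %| C2) => /=; lia.
Qed.

(* Minimality at m = n - 1 gives 3 m <= 10 beta ln m; then ln m <= 2 sqrt m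
   yields m = O(beta ^ 2), hence ln m = O(ln beta). *)
Lemma first_n_bound (mu : R) : (0 < mu)%R -> exists N0 : nat, 7 <= N0 /\
  forall beta n : nat, is_first_n mu beta n -> N0 <= beta ->
  (INR n <= 15 * (INR beta * ln (INR beta)))%R.
Proof.
move=> mu0.
(* Beyond this threshold m = n - 1 still satisfies m > 21 and m > mu, and ln m >= 10 mu / 3 makes mu
   / ln m at most half of 3/5. *)
have [N1 hN1] := INR_unbounded (22 + mu + exp (10 * mu / 3)).
have e0 := exp_pos (10 * mu / 3).
have N1_22 : 22 < N1.
  by apply/ltP/INR_lt; rewrite (_ : INR 22 = 22)%R; [lra | rewrite /=; lra].
exists N1; split; first by lia.
move=> beta n [[n21 [mun ups]] first] Nb.
have bN : (INR N1 <= INR beta)%R by apply: le_INR; apply/leP.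
have nR : (22 <= INR n)%R by rewrite (_ : 22%R = INR 22); [apply: le_INR; lia | rewrite /=; lra].
have [[a1 a2] [[b1 b2] [c1 c2]]] := ln_2_3_5_bounds.
have lnn : (3 / 5 < ln (INR n))%R.
  by apply: Rlt_le_trans (_ : ln 2 <= _)%R; [lra | apply: ln_le; lra].
(* [Upsilon mu n] is at most n, so m >= beta inherits the threshold; by minimality m can then only
   fail the condition on [Upsilon]. *)
have bn : beta < n.
  apply/ltP/INR_lt; apply: Rlt_le_trans ups _; rewrite /Upsilon.
  have : (0 <= mu * INR n / ln (INR n) ^ 2)%R.
    by apply: Rdiv_le_0_compat; [nra | apply: pow_lt; lra].
  have : (3 * INR n / (5 * ln (INR n)) <= INR n)%R.
    by apply/Rle_div_l; [lra | nra].
  lra.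
pose m := n.-1.
have mn : INR n = (INR m + 1)%R by rewrite -S_INR /m prednK //; lia.
have mb : (INR beta <= INR m)%R by apply: le_INR; rewrite /m; lia.
have := first m ltac:(rewrite /m; lia).
have lnm : (10 * mu / 3 <= ln (INR m))%R.
  by rewrite -[X in (X <= _)%R]ln_exp; apply: ln_le; lra.
move=> nc; have {nc} U : (Upsilon mu (INR m) <= INR beta)%R.
  apply: Rnot_lt_le => h; apply: nc; split; first by rewrite /m; lia.
  by split; [lra | exact: h].
set X := INR m in mn mb lnm U *; set L := ln X in lnm U *.
have L0 : (0 < L)%R by lra.
have h1 : (3 * X <= 10 * INR beta * L)%R.
  have E : (Upsilon mu X = X / L * (3 / 5 - mu / L))%R.
    by rewrite /Upsilon -/L; field; lra.
  have : (mu / L <= 3 / 10)%R by apply/Rle_div_l; lra.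
  have XL : (0 < X / L)%R by apply: Rdiv_lt_0_compat; lra.
  rewrite E in U => h3.
  have : (X / L * (3 / 10) <= INR beta)%R by nra.
  have -> : (X / L * (3 / 10) = (3 * X / 10) / L)%R by field; lra.
  by move/Rle_div_l => /(_ L0); lra.
pose r := sqrt X.
have rr : (r * r = X)%R by apply: sqrt_sqrt; lra.
have r0 : (0 < r)%R by apply: sqrt_lt_R0; lra.
have Lr : (L = 2 * ln r)%R by rewrite /L -rr ln_mult; lra.
have lr : (ln r <= r)%R.
  rewrite -[X in (_ <= X)%R]ln_exp; apply: ln_le; first by lra.
  have := exp_ineq1_le r; lra.
(* From 3 r ^ 2 <= 20 beta ln r <= 20 beta r. As beta >= 7, this gives r <= beta ^ 2 below. *)
have rb : (r <= 20 / 3 * INR beta)%R.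
  have : (r * (3 * r) <= r * (20 * INR beta))%R by nra.
  move/(Rmult_le_reg_l _ _ _ r0); lra.
have Lb : (L <= 4 * ln (INR beta))%R.
  have : (ln r <= ln (INR beta * INR beta))%R by apply: ln_le; nra.
  rewrite ln_mult; lra.
have lb : (1 <= ln (INR beta))%R.
  apply: Rle_trans (_ : ln 3 <= _)%R; [lra | apply: ln_le; lra].
have : (INR beta * L <= 4 * (INR beta * ln (INR beta)))%R by nra.
(* Now m <= 40/3 beta ln beta, and the remaining 5/3 beta ln beta absorbs n - m = 1. *)
have : (22 <= INR beta * ln (INR beta))%R by nra.
rewrite mn; lra.
Qed.

Theorem mainTheorem4 (mu : R) (Hmu : (0 < mu)%R) (Hmu_hyp : mu_hyp mu) :
  (forall (C1 C2 b1 b2 l n : nat),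
      0 < C1 -> 0 < C2 ->
      (log2 (INR C1) <= INR b1)%R -> (log2 (INR C2) <= INR b2)%R ->
      is_first_n mu (b1 + b2 + l) n ->
      b1 + b2 + l <= count prime (Pseq n) /\
      l <= count (fun p => prime p && useful C1 C2 p) (Pseq n))
  /\
  (exists (K : R) (N0 : nat),
    forall (C1 C2 b1 b2 l n : nat),
      0 < C1 -> 0 < C2 ->
      (log2 (INR C1) <= INR b1)%R -> (log2 (INR C2) <= INR b2)%R ->
      is_first_n mu (b1 + b2 + l) n ->
      N0 <= b1 + b2 + l ->
      forall p, p \in Pseq n ->
        (INR p <= K * Rpower (INR (b1 + b2 + l)) e189
                   * Rpower (ln (INR (b1 + b2 + l))) e189)%R).
Proof.
split=> [C1 C2 b1 b2 l n C10 C20 h1 h2 [nc _]|].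
  have sz := size_Qseq_gt mu _ n Hmu_hyp nc.
  have us := count_useful_Pseq C1 C2 b1 b2 n C10 C20 h1 h2.
  split; last by lia.
  have := Pseq_prime n; rewrite all_count => /eqP ->.
  by rewrite Pseq_map size_map ltnW.
have [N0 [N07 H]] := first_n_bound mu Hmu.
(* 30 = 2 * 15, since q < 2 n and n <= 15 beta ln beta. *)
exists (Rpower 30 e189), N0 => C1 C2 b1 b2 l n _ _ _ _ fn Nb p.
have hn := H _ _ fn Nb; set beta := b1 + b2 + l in Nb hn *.
have bR : (7 <= INR beta)%R.
  by rewrite (_ : 7%R = INR 7); [apply: le_INR; lia | rewrite /=; lra].
have lb : (0 < ln (INR beta))%R by rewrite -ln_1; apply: ln_increasing; lra.
rewrite Pseq_map => /mapP[q]; rewrite mem_Qseq => /and3P[pq lq /andP[_ q2n]] ->.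
rewrite Rpower_mult_distr; try lra.
rewrite Rpower_mult_distr //; last by lra.
apply: Rlt_le; apply: Rlt_le_trans (Slt_ltR q lq) _.
have q0 : (0 < INR q)%R by apply: lt_0_INR; have := prime_gt0 pq; lia.
apply: Rle_Rpower_l; first by rewrite /e189; lra.
split=> //.
have : (INR q <= 2 * INR n)%R.
  by rewrite -[2%R]/(INR 2) -mult_INR; apply: le_INR; lia.
lra.
Qed.
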